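(* Let $X$ be a Euclidean space. For any blades $A,B\in\bigwedge X$, \begin{align*} |A*B| &= \|A\|\|B\|\cos\hat{\Theta}_{[A],[B]},\\ \|A\rfloor B\| &= \|A\|\|B\|\cos\Theta_{[A],[B]},\\ \|A\lfloor B\| &= \|A\|\|B\|\cos\Theta_{[B],[A]},\\ \|A\bullet B\| &= \|A\|\|B\|\cos\check{\Theta}_{[A],[B]},\\ \|A\cdot B\| &= \|A\|\|B\|\cos\check{\Theta}_{[A],[B]}\quad\text{(if $A,B$ are non-scalars)},\\ \|A\wedge B\| &= \|A\|\|B\|\cos\Theta^\perp_{[A],[B]}. \end{align*}
   Context: $X$ is an $n$-dimensional Euclidean space. $\bigwedge X$ is its exterior algebra, equipped with the Clifford geometric product (written by juxtaposition), for which $vw=v\cdot w+v\wedge w$ for $v,w\in X$. $\bigwedge X$ carries the usual inner product and norm $\|\cdot\|$. $\langle M\rangle_k$ is the grade-$k$ component of $M$. A $p$-blade ($p\ge1$) is $A=v_1\wedge\cdots\wedge v_p$ with $v_i\in X$; if $A\ne0$, $[A]=\mathrm{span}(v_1,\ldots,v_p)$. Scalars are $0$-blades, with $[A]=\{0\}$; $0$ is a $p$-blade for every $p$, with $[0]=\{0\}$. Products: for a $p$-blade $A$ and a $q$-blade $B$, the scalar product $A*B$, left contraction $A\rfloor B$, right contraction $A\lfloor B$, (fat) dot product $A\bullet B$ and outer product $A\wedge B$ are the components of the geometric product $AB$ of grades $0$, $q-p$, $p-q$, $|q-p|$ and $p+q$, respectively (a negative grade means the component is $0$). Hestenes inner product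 $A\cdot B$ is the component of grade $|q-p|$ of $AB$ if $p,q\ne0$, and $0$ otherwise. Angles: for subspaces $V,W\subset X$ with $p=\dim V$, $P_W$ the orthogonal projection onto $W$, and $S\subset V$ any non-degenerate $p$-dimensional parallelotope, the projection factor is $\pi_{V,W}=\frac{\mathrm{vol}_p(P_W(S))}{\mathrm{vol}_p(S)}$ (with $\mathrm{vol}_0$ of a point equal to $1$), and the asymmetric angle $\Theta_{V,W}\in[0,\frac\pi2]$ is given by $\cos\Theta_{V,W}=\pi_{V,W}$. Also $\hat\Theta_{V,W}=\max\{\Theta_{V,W},\Theta_{W,V}\}$, $\check\Theta_{V,W}=\min\{\Theta_{V,W},\Theta_{W,V}\}$, and $\Theta^\perp_{V,W}=\Theta_{V,W^\perp}$, where $W^\perp$ is the orthogonal complement of $W$. *)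

(* Defs.v *)
From HB Require Import structures.
From mathcomp Require Import all_boot all_order all_algebra.
From mathcomp Require Import sesquilinear.
From mathcomp Require Import reals trigo.

Set Implicit Arguments.
Unset Strict Implicit.
Unset Printing Implicit Defensive.

Import Order.TTheory GRing.Theory Num.Theory.
Local Open Scope ring_scope.

Section SymmetricDifference.
Variable n : nat.
Implicit Types S T U : {set 'I_n}.

Definition symdiff S T := (S :\: T) :|: (T :\: S).

Lemma in_symdiff S T i : (i \in symdiff S T) = (i \in S) (+) (i \in T).
Proof. by rewrite !inE; do 2!case: (i \in _). Qed.

Lemma symdiffA S T U : symdiff S (symdiff T U) = symdiff (symdiff S T) U.
Proof. by apply/setP=> i; rewrite !in_symdiff addbA. Qed.

Lemma symdiff0s S : symdiff set0 S = S.
Proof. by apply/setP=> i; rewrite in_symdiff inE. Qed.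

Lemma symdiffs0 S : symdiff S set0 = S.
Proof. by apply/setP=> i; rewrite in_symdiff inE addbF. Qed.

Lemma symdiffss S : symdiff S S = set0.
Proof. by apply/setP=> i; rewrite in_symdiff inE addbb. Qed.

Lemma card_symdiff S T : (#|symdiff S T| + (#|S :&: T|).*2 = #|S| + #|T|)%N.
Proof.
rewrite /symdiff cardsU; have -> : (S :\: T) :&: (T :\: S) = set0.
  by apply/setP=> i; rewrite !inE; do 2!case: (i \in _).
rewrite cards0 subn0 -(cardsID T S) -(cardsID S T) (setIC T S) -addnn addnACA.
by rewrite (addnC #|S :\: T|) (addnC #|T :\: S|).
Qed.

End SymmetricDifference.

(* The exterior algebra of a Euclidean space with orthonormal basis           *)
(* e_0, ..., e_(n-1), in coordinates: A S is the coefficient of A on          *)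
(* e_S = e_i1 /\ ... /\ e_ik, where S = {i1 < ... < ik}.                      *)
Definition multivector (R : comNzRingType) (n : nat) : Type :=
  {ffun {set 'I_n} -> R^o}.

Section Multivector.
Variables (R : comNzRingType) (n : nat).
Local Notation mv := (multivector R n).
Implicit Types (S T U : {set 'I_n}) (A B C : mv).

HB.instance Definition _ := GRing.Lmodule.copy mv {ffun {set 'I_n} -> R^o}.

Definition mvbasis S : mv := [ffun T => (T == S)%:R].

(* The sign of the permutation sorting the concatenation of the increasing    *)
(* enumerations of S and T: one factor -1 per pair i in S, j in T with j < i. *)
Definition reorder_sign S T : R :=
  \prod_(i in S) \prod_(j in T | (j < i)%N) (-1).

Definition mvproduct (c : {set 'I_n} -> {set 'I_n} -> R) A B : mv :=
  \sum_S \sum_T (c S T * (A S * B T)) *: mvbasis (symdiff S T).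

(* e_S e_T = +- e_(S symdiff T), since e_i e_i = 1 and e_i e_j = - e_j e_i.   *)
Definition geomprod : mv -> mv -> mv := mvproduct reorder_sign.

(* e_S /\ e_T = +- e_(S :|: T) if S and T are disjoint, and 0 otherwise.      *)
Definition wedge : mv -> mv -> mv :=
  mvproduct (fun S T => if [disjoint S & T] then reorder_sign S T else 0).

(* The index is an integer, so the components of negative grade are 0.       *)
Definition grade (k : int) A : mv :=
  [ffun S : {set 'I_n} => if #|S|%:Z == k then A S else 0].

Lemma prod_symdiff (f : 'I_n -> R) S T : (forall i, f i * f i = 1) ->
  \prod_(i in symdiff S T) f i = (\prod_(i in S) f i) * (\prod_(i in T) f i).
Proof.
move=> f2; rewrite big_mkcond [X in X * _]big_mkcond [X in _ * X]big_mkcond -big_split.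
apply: eq_bigr => i _; rewrite in_symdiff.
by do 2!case: (i \in _); rewrite /= ?mulr1 ?mul1r ?f2.
Qed.

Lemma prodN1_sq (I : finType) (P : pred I) :
  (\prod_(i | P i) (-1 : R)) * (\prod_(i | P i) (-1)) = 1.
Proof. by rewrite -big_split /= big1 // => i _; rewrite mulrNN mulr1. Qed.

Lemma reorder_signDl S T U :
  reorder_sign (symdiff S T) U = reorder_sign S U * reorder_sign T U.
Proof. by apply: prod_symdiff => i; exact: prodN1_sq. Qed.

Lemma reorder_signDr S T U :
  reorder_sign S (symdiff T U) = reorder_sign S T * reorder_sign S U.
Proof.
rewrite /reorder_sign -big_split /=; apply: eq_bigr => i _.
rewrite !big_mkcondr prod_symdiff // => j.
by case: ifP; rewrite ?mulrNN mulr1.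
Qed.

Lemma reorder_sign0l S : reorder_sign set0 S = 1.
Proof. by rewrite /reorder_sign big_set0. Qed.

Lemma reorder_sign0r S : reorder_sign S set0 = 1.
Proof. by rewrite /reorder_sign big1 // => i _; rewrite big1 // => j; rewrite inE. Qed.

Lemma mvbasisE S T : mvbasis S T = (T == S)%:R.
Proof. by rewrite ffunE. Qed.

Lemma mv_decomp A : A = \sum_S A S *: mvbasis S.
Proof.
apply/ffunP=> T; rewrite sum_ffunE (bigD1 T) //= big1 ?addr0 => [|S neST].
  by rewrite !ffunE eqxx /GRing.scale /= mulr1.
by rewrite !ffunE eq_sym (negPf neST) /GRing.scale /= mulr0.
Qed.

Lemma mv_scaleE a A S : (a *: A) S = a * A S.
Proof. by rewrite ffunE. Qed.

Section Product.
Variable c : {set 'I_n} -> {set 'I_n} -> R.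
Local Notation "A *c B" := (mvproduct c A B) (at level 40).

Lemma mvproductDl A B C : (A + B) *c C = A *c C + B *c C.
Proof.
rewrite -big_split; apply: eq_bigr => S _; rewrite -big_split.
by apply: eq_bigr => T _; rewrite /= -scalerDl ffunE mulrDl mulrDr.
Qed.

Lemma mvproductDr A B C : A *c (B + C) = A *c B + A *c C.
Proof.
rewrite -big_split; apply: eq_bigr => S _; rewrite -big_split.
by apply: eq_bigr => T _; rewrite /= -scalerDl ffunE mulrDr mulrDr.
Qed.

Lemma mvproductZl a A B : (a *: A) *c B = a *: (A *c B).
Proof.
rewrite scaler_sumr; apply: eq_bigr => S _; rewrite scaler_sumr.
apply: eq_bigr => T _; rewrite scalerA mv_scaleE; congr (_ *: _).
by rewrite -!mulrA mulrCA.
Qed.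

Lemma mvproductZr a A B : A *c (a *: B) = a *: (A *c B).
Proof.
rewrite scaler_sumr; apply: eq_bigr => S _; rewrite scaler_sumr.
apply: eq_bigr => T _; rewrite scalerA mv_scaleE; congr (_ *: _).
by rewrite (mulrCA (A S) a) (mulrCA _ a).
Qed.

Lemma mvproduct0l A : 0 *c A = 0.
Proof.
by rewrite /mvproduct big1 // => S _; rewrite big1 // => T _;
  rewrite ffunE mul0r mulr0 scale0r.
Qed.

Lemma mvproduct0r A : A *c 0 = 0.
Proof.
by rewrite /mvproduct big1 // => S _; rewrite big1 // => T _;
  rewrite ffunE !mulr0 scale0r.
Qed.

Lemma mvproduct_suml (I : Type) (r : seq I) (P : pred I) (F : I -> mv) A :
  (\sum_(i <- r | P i) F i) *c A = \sum_(i <- r | P i) F i *c A.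
Proof. exact: (big_morph _ (fun B C => mvproductDl B C A) (mvproduct0l A)). Qed.

Lemma mvproduct_sumr (I : Type) (r : seq I) (P : pred I) (F : I -> mv) A :
  A *c (\sum_(i <- r | P i) F i) = \sum_(i <- r | P i) A *c F i.
Proof. exact: (big_morph _ (mvproductDr A) (mvproduct0r A)). Qed.

Lemma mvproduct_basis S T :
  mvbasis S *c mvbasis T = c S T *: mvbasis (symdiff S T).
Proof.
rewrite /mvproduct (bigD1 S) //= (bigD1 T) //= !mvbasisE !eqxx !mulr1.
rewrite !big1 ?addr0 // => [U neUS|U neUT].
  by rewrite big1 // => V _; rewrite mvbasisE (negPf neUS) mul0r mulr0 scale0r.
by rewrite !mvbasisE (negPf neUT) !mulr0 scale0r.
Qed.

Lemma mvproduct_decompl A B : A *c B = \sum_S A S *: (mvbasis S *c B).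
Proof.
rewrite {1}(mv_decomp A) mvproduct_suml.
by apply: eq_bigr => S _; rewrite mvproductZl.
Qed.

Lemma mvproduct_decompr A B : A *c B = \sum_S B S *: (A *c mvbasis S).
Proof.
rewrite {1}(mv_decomp B) mvproduct_sumr.
by apply: eq_bigr => S _; rewrite mvproductZr.
Qed.

Hypothesis c_cocycle : forall S T U,
  c T U * c S (symdiff T U) = c S T * c (symdiff S T) U.

Lemma mvproductA : associative (mvproduct c).
Proof.
move=> A B C.
rewrite (mvproduct_decompl A) (mvproduct_decompl A B) mvproduct_suml.
apply: eq_bigr => S _; rewrite mvproductZl; congr (_ *: _).
rewrite (mvproduct_decompl B) (mvproduct_decompr _ B).
rewrite mvproduct_sumr mvproduct_suml.
apply: eq_bigr => T _; rewrite mvproductZl mvproductZr; congr (_ *: _).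
rewrite (mvproduct_decompr _ C) [RHS](mvproduct_decompr _ C) mvproduct_sumr.
apply: eq_bigr => U _; rewrite mvproductZr; congr (_ *: _).
by rewrite !mvproduct_basis mvproductZr mvproductZl !mvproduct_basis
           !scalerA c_cocycle symdiffA.
Qed.

Hypotheses (c0l : forall S, c set0 S = 1) (c0r : forall S, c S set0 = 1).

Lemma mvproduct1l : left_id (mvbasis set0) (mvproduct c).
Proof.
move=> A; rewrite mvproduct_decompr [RHS]mv_decomp.
by apply: eq_bigr => S _; rewrite mvproduct_basis c0l scale1r symdiff0s.
Qed.

Lemma mvproduct1r : right_id (mvbasis set0) (mvproduct c).
Proof.
move=> A; rewrite mvproduct_decompl [RHS]mv_decomp.
by apply: eq_bigr => S _; rewrite mvproduct_basis c0r scale1r symdiffs0.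
Qed.

End Product.

Lemma geomprodA : associative geomprod.
Proof.
apply: mvproductA => S T U; rewrite reorder_signDl reorder_signDr.
by rewrite mulrC -mulrA.
Qed.

Lemma mvbasis0_neq0 : mvbasis set0 != 0.
Proof.
by apply/eqP=> /ffunP/(_ set0)/eqP; rewrite !ffunE eqxx oner_eq0.
Qed.

(* From here on, A * B is the geometric product.                              *)
HB.instance Definition _ := GRing.Zmodule_isNzRing.Build mv geomprodA
  (mvproduct1l reorder_sign0l) (mvproduct1r reorder_sign0r)
  (@mvproductDl reorder_sign) (@mvproductDr reorder_sign) mvbasis0_neq0.

HB.instance Definition _ := GRing.Lmodule_isLalgebra.Build R mv
  (fun a A B => esym (@mvproductZl reorder_sign a A B)).

HB.instance Definition _ := GRing.Lalgebra_isAlgebra.Build R mv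
  (fun a A B => esym (@mvproductZr reorder_sign a A B)).

Lemma mv1E : 1 = mvbasis set0 :> mv. Proof. by []. Qed.

Lemma wedgeA : associative wedge.
Proof.
apply: mvproductA => S T U; rewrite reorder_signDl reorder_signDr.
have [dST|nST] := boolP [disjoint S & T]; last first.
  rewrite mul0r; case: ifP => dTU; last by rewrite mul0r.
  case: ifP => [dS|_]; last by rewrite mulr0.
  case/negP: nST; apply/pred0P=> i /=; apply/negP=> /andP[iS iT].
  move: (disjointFr dS iS); rewrite in_symdiff iT.
  by rewrite (disjointFr dTU iT).
have [dTU|nTU] := boolP [disjoint T & U]; last first.
  rewrite mul0r; case: ifP => [dS|_]; last by rewrite mulr0.
  case/negP: nTU; apply/pred0P=> i /=; apply/negP=> /andP[iT iU].
  by move: (disjointFl dS iU); rewrite in_symdiff iT (disjointFl dST iT).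
have -> : [disjoint S & symdiff T U] = [disjoint symdiff S T & U].
  rewrite -!setI_eq0; congr (_ == _); apply/setP=> i; rewrite !in_setI !in_symdiff.
  move: (@disjointFr _ _ _ i dST) (@disjointFr _ _ _ i dTU).
  by do 3!case: (i \in _) => //=; move=> // h1 h2;
    by [move: (h1 isT) | move: (h2 isT)].
case: ifP => _; last by rewrite !mulr0.
by rewrite mulrC -mulrA.
Qed.

Lemma wedge1l : left_id 1 wedge.
Proof.
apply: mvproduct1l => S; rewrite reorder_sign0l ifT //.
by rewrite -setI_eq0 set0I.
Qed.

Lemma wedge1r : right_id 1 wedge.
Proof.
apply: mvproduct1r => S; rewrite reorder_sign0r ifT //.
by rewrite -setI_eq0 setI0.
Qed.

Lemma wedge_grade (p q : nat) A B :
  grade p%:Z A = A -> grade q%:Z B = B -> wedge A B = grade (p%:Z + q%:Z) (A * B).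
Proof.
move=> Ap Bq; have gP k C S : grade k%:Z C = C -> #|S| != k -> C S = 0.
  by move=> /ffunP/(_ S) <-; rewrite ffunE eqz_nat => /negPf->.
apply/ffunP=> U; rewrite [RHS]ffunE [in RHS]/GRing.mul /=.
rewrite /wedge /geomprod /mvproduct !sum_ffunE.
apply/esym.
have -> : (if #|U|%:Z == p%:Z + q%:Z then
   \sum_S (\sum_T (reorder_sign S T * (A S * B T)) *: mvbasis (symdiff S T)) U
   else 0) = \sum_S \sum_T (if (#|U| == p + q)%N then
   (reorder_sign S T * (A S * B T)) *: (mvbasis (symdiff S T) U : R^o) else 0).
  rewrite -PoszD eqz_nat; case: ifP => _; last by rewrite !big1.
  apply: eq_bigr => S _; rewrite sum_ffunE; apply: eq_bigr => T _.
  by rewrite ffunE.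
apply: eq_bigr => S _; rewrite sum_ffunE; apply: eq_bigr => T _.
rewrite [RHS]ffunE.
have [cS|] := eqVneq #|S| p; last first.
  by move/(gP _ A _ Ap) => ->; rewrite mul0r !mulr0 scale0r if_same.
have [cT|] := eqVneq #|T| q; last first.
  by move/(gP _ B _ Bq) => ->; rewrite !mulr0 scale0r if_same.
rewrite [mvbasis _ U]ffunE; have [->|_] := eqVneq U; last first.
  by rewrite !scaler0 if_same.
have := card_symdiff S T; rewrite cS cT -setI_eq0 -cards_eq0 => <-.
rewrite -{1}[#|symdiff S T|]addn0 eqn_add2l eq_sym double_eq0.
by case: ifP; rewrite // mul0r scale0r.
Qed.

End Multivector.

Section Euclidean.
Variables (R : realType) (X : vectType R) (dot : {dot X for idfun}).
Implicit Types (v w : X) (V W : {vspace X}).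

Lemma dotC v w : dot v w = dot w v.
Proof. by rewrite (hermC (theta := idfun)) expr0 mul1r. Qed.

Lemma dot_ge0 v : 0 <= dot v v.
Proof.
by have [->|/neq0_dnorm_gt0/ltW//] := eqVneq v 0; rewrite linear0r.
Qed.

Lemma dot_eq0 v : (dot v v == 0) = (v == 0).
Proof.
have [->|v0] := eqVneq v 0; first by rewrite linear0r eqxx.
by rewrite gt_eqF // neq0_dnorm_gt0.
Qed.

Lemma dotDl u v w : dot (u + v) w = dot u w + dot v w.
Proof. exact: linearDl. Qed.

Lemma dotDr u v w : dot w (u + v) = dot w u + dot w v.
Proof. exact: linearDr. Qed.

Lemma dotZl a v w : dot (a *: v) w = a * dot v w.
Proof. exact: linearZl_LR. Qed.

Lemma dotZr a v w : dot v (a *: w) = a * dot v w.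
Proof. by rewrite dotC dotZl dotC. Qed.

Lemma dot_suml (I : Type) (r : seq I) (P : pred I) (F : I -> X) v :
  dot (\sum_(i <- r | P i) F i) v = \sum_(i <- r | P i) dot (F i) v.
Proof. exact: linear_sumlz. Qed.

Lemma dot_sumr (I : Type) (r : seq I) (P : pred I) (F : I -> X) v :
  dot v (\sum_(i <- r | P i) F i) = \sum_(i <- r | P i) dot v (F i).
Proof. exact: linear_sumr. Qed.

Lemma orthonormal_dot p (s : p.-tuple X) : orthonormal dot s ->
  forall i j, dot (tnth s i) (tnth s j) = (i == j)%:R.
Proof.
elim: p s => [|p IHp] s; first by move=> _ [].
case/tupleP: s => v s; rewrite /orthonormal /=.
case/andP=> /andP[/eqP v1 s1] /andP[]; rewrite andbT => /allP vs os.
have {}IHp := IHp s (introT andP (conj s1 os)).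
have vs0 k : dot v (tnth s k) = 0 by apply/eqP/vs/mem_tnth.
move=> i j; case: (unliftP ord0 i) => [i'|] ->;
  case: (unliftP ord0 j) => [j'|] ->; rewrite ?tnthS ?tnth0 ?eqxx //.
by rewrite dotC vs0.
Qed.

Lemma orthonormal_freeR p (s : p.-tuple X) : orthonormal dot s -> free s.
Proof.
move/orthonormal_dot=> os; apply/freeP=> k k0 i.
have : dot (tnth s i) (\sum_j k j *: s`_j) = 0 by rewrite k0 linear0r.
rewrite dot_sumr (bigD1 i) //=.
rewrite dotZr -tnth_nth os eqxx mulr1 big1 ?addr0 // => j neji.
by rewrite dotZr -tnth_nth os eq_sym (negPf neji) mulr0.
Qed.

Lemma orthonormal_basis_exists W :
  exists2 s : (\dim W).-tuple X, basis_of W s & orthonormal dot s.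
Proof.
suff H m : (m <= \dim W)%N ->
    exists2 s : m.-tuple X, (<<s>> <= W)%VS & orthonormal dot s.
  have [s sW os] := H _ (leqnn _); exists s => //.
  by rewrite basisEfree (orthonormal_freeR os) sW size_tuple leqnn.
elim: m => [_|m IHm ltmW]; first by exists [tuple] => //; rewrite span_nil sub0v.
have [s sW os] := IHm (ltnW ltmW).
have /subvPn[w wW wNs] : ~~ (W <= <<s>>)%VS.
  apply: contraTN ltmW => /dimvS Ws; rewrite -leqNgt (leq_trans Ws) //.
  by rewrite (leq_trans (dim_span _)) // size_tuple.
pose h := w - \sum_i dot w (tnth s i) *: tnth s i.
have sumW : \sum_i dot w (tnth s i) *: tnth s i \in <<s>>%VS.
  by apply: memv_suml => i _; rewrite memvZ // memv_span // mem_tnth.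
have h0 : h != 0.
  by apply: contraNneq wNs => /eqP; rewrite subr_eq0 => /eqP ->.
have hs i : dot h (tnth s i) = 0.
  rewrite /h linearBl /= dot_suml (bigD1 i) //= dotZl orthonormal_dot //.
  rewrite eqxx mulr1 big1 ?addr0 ?subrr // => j neji.
  by rewrite dotZl orthonormal_dot // (negPf neji) mulr0.
pose u := (Num.sqrt (dot h h))^-1 *: h.
exists [tuple of u :: s].
  rewrite span_cons subv_add sW andbT -memvE memvZ // memvB //.
  exact: subvP sW _ sumW.
move: os; rewrite /orthonormal /= => /andP[-> ->]; rewrite !andbT.
rewrite dotZl dotZr mulrA -invfM -expr2 sqr_sqrtr ?dot_ge0 //.
rewrite mulVf ?dot_eq0 // eqxx /=.
by apply/allP=> x /tnthP[i ->] /=; rewrite dotZl hs mulr0.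
Qed.

Definition orthonormal_basis n (e : n.-tuple X) : bool :=
  basis_of fullv e && orthonormal dot e.

Definition orthoproj W : 'End(X) := daddv_pi W (orthov dot W).

Lemma orthoprojP W v :
  orthoproj W v \in W /\ v - orthoproj W v \in orthov dot W.
Proof.
have dWW : (W :&: orthov dot W = 0)%VS.
  apply/eqP; rewrite -subv0; apply/subvP=> u.
  rewrite memv_cap memv0 -dot_eq0 => /andP[uW /mem_orthovP/(_ u uW) ->].
  by rewrite eqxx.
split; first exact: memv_pi.
have [s bs os] := orthonormal_basis_exists W.
pose w := \sum_i dot v (tnth s i) *: tnth s i.
have wW : w \in W.
  by apply: memv_suml => i _; rewrite memvZ // (basis_mem bs) // mem_tnth.
have vw : v - w \in orthov dot W.
  apply/mem_orthovP=> u; rewrite -(span_basis bs) => /coord_span ->.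
  rewrite -[LHS]/(dot _ _) dot_sumr big1 // => i _; rewrite dotZr -tnth_nth.
  rewrite linearBl /= dot_suml (bigD1 i) //= dotZl orthonormal_dot //.
  rewrite eqxx mulr1 big1 ?addr0 ?subrr ?mulr0 // => j neji.
  by rewrite dotZl orthonormal_dot // (negPf neji) mulr0.
have vWW : v \in (W + orthov dot W)%VS.
  by rewrite -(subrK w v) addrC memv_add.
rewrite -{1}(daddv_pi_add dWW vWW) /orthoproj addrC addKr.
exact: memv_pi.
Qed.

(* The p-dimensional volume of the parallelotope with edges s (Gram).         *)
Definition gram p (s : p.-tuple X) : 'M[R]_p :=
  \matrix_(i, j) dot (tnth s i) (tnth s j).

Definition volume p (s : p.-tuple X) : R := Num.sqrt (\det (gram s)).

Lemma gram_comb p q (P : 'M[R]_(p, q)) (s : p.-tuple X) (t : q.-tuple X) :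
  (forall i, tnth s i = \sum_j P i j *: tnth t j) ->
  gram s = P *m gram t *m P^T.
Proof.
move=> sE; apply/matrixP=> i j; rewrite !mxE !sE dot_sumr.
apply: eq_bigr => k _; rewrite dotZr !mxE mulrC; congr (_ * _).
by rewrite dot_suml; apply: eq_bigr => l _; rewrite dotZl mxE.
Qed.

Lemma volume_comb p (P : 'M[R]_p) (s t : p.-tuple X) :
  (forall i, tnth s i = \sum_j P i j *: tnth t j) ->
  volume s = `|\det P| * volume t.
Proof.
move=> /gram_comb sE; rewrite /volume sE !det_mulmx det_tr mulrAC -expr2.
by rewrite sqrtrM ?sqr_ge0 // sqrtr_sqr.
Qed.

Lemma volume0 (s : 0.-tuple X) : volume s = 1.
Proof. by rewrite /volume det_mx00 sqrtr1. Qed.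

(* Volume is height times base.                                               *)
Lemma volume_cons p v (s : p.-tuple X) (h := v - orthoproj <<s>> v) :
  volume [tuple of v :: s] = Num.sqrt (dot h h) * volume s.
Proof.
have [vs ho] := orthoprojP <<s>> v; rewrite -/h in ho.
have hs j : dot h (tnth s j) = 0.
  by move/mem_orthovP: ho; apply; rewrite memv_span // mem_tnth.
pose c j := coord s j (orthoproj <<s>> v).
pose P : 'M[R]_p.+1 := \matrix_(i, j)
  match unlift ord0 i, unlift ord0 j with
  | None, None => 1 | None, Some j => c j
  | Some _, None => 0 | Some i, Some j => (i == j)%:R end.
have detP : \det P = 1.
  rewrite -det_tr det_trig.
    by rewrite big1 // => i _; rewrite !mxE; case: unliftP => // j _; rewrite eqxx.
  apply/is_trig_mxP => i j ltij; rewrite !mxE.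
  case: (unliftP ord0 j) ltij => [j'|] -> //; case: (unliftP ord0 i) => [i'|] -> //.
  rewrite /= /bump /= !add1n ltnS => ltij.
  by case: eqP => // eij; rewrite eij ltnn in ltij.
rewrite (@volume_comb _ P _ [tuple of h :: s]); last first.
  move=> i; rewrite big_ord_recl tnth0 !mxE unlift_none.
  under eq_bigr do rewrite !mxE liftK tnthS.
  case: (unliftP ord0 i) => [i'|] ->.
    rewrite tnthS scale0r add0r (bigD1 i') //= eqxx scale1r big1 ?addr0 //.
    by move=> j neji; rewrite eq_sym (negPf neji) scale0r.
  rewrite tnth0 scale1r /c.
  under eq_bigr do rewrite (tnth_nth 0).
  by rewrite -coord_span // /h subrK.
rewrite detP normr1 mul1r /volume -sqrtrM ?dot_ge0 //; congr Num.sqrt.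
rewrite (expand_det_row _ ord0) big_ord_recl big1 ?addr0 => [|i _]; last first.
  by rewrite !mxE tnth0 tnthS hs mul0r.
rewrite mxE tnth0 /cofactor expr0 mul1r; congr (_ * \det _).
by apply/matrixP=> i j; rewrite !mxE !tnthS.
Qed.

Lemma volume_gt0 p (s : p.-tuple X) : free s -> 0 < volume s.
Proof.
elim: p s => [|p IHp] s; first by rewrite volume0 ltr01.
case/tupleP: s => v s; rewrite free_cons => /andP[vs fs].
rewrite volume_cons mulr_gt0 ?IHp // sqrtr_gt0 neq0_dnorm_gt0 //.
apply: contraNneq vs => /eqP; rewrite subr_eq0 => /eqP ->.
by case: (orthoprojP <<s>> v).
Qed.

(* The edges of S are taken to be the basis vbasis V; projfactorE shows that  *)
(* any other basis of V gives the same ratio.                                 *)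
Definition projfactor V W : R :=
  volume (map_tuple (orthoproj W) (vbasis V)) / volume (vbasis V).

Lemma projfactorE V W (s : (\dim V).-tuple X) : basis_of V s ->
  projfactor V W = volume (map_tuple (orthoproj W) s) / volume s.
Proof.
move=> bs; pose b := vbasis V; have bb : basis_of V b := vbasisP V.
pose P := \matrix_(i, j) coord b j (tnth s i).
pose Q := \matrix_(i, j) coord s j (tnth b i).
have sE i : tnth s i = \sum_j P i j *: tnth b j.
  rewrite [LHS](coord_basis bb) ?(basis_mem bs) ?mem_tnth //.
  by apply: eq_bigr => j _; rewrite mxE -tnth_nth.
have QP : Q *m P = 1%:M.
  apply/matrixP=> i k; rewrite !mxE.
  under eq_bigr do rewrite !mxE (tnth_nth 0 s) -linearZ.
  have bV : tnth b i \in V by rewrite (basis_mem bb) // mem_tnth.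
  rewrite -linear_sum -(coord_basis bs bV) (tnth_nth 0).
  exact: coord_free (basis_free bb).
have P0 : `|\det P| != 0.
  rewrite normr_eq0; apply/eqP=> P0.
  have /eqP := congr1 determinant QP.
  by rewrite det_mulmx P0 mulr0 det1 eq_sym oner_eq0.
rewrite (volume_comb sE) (@volume_comb _ P _ (map_tuple (orthoproj W) b)).
  by rewrite -mulf_div divff // mul1r.
move=> i; rewrite tnth_map sE linear_sum.
by apply: eq_bigr => j _; rewrite linearZ tnth_map.
Qed.

(* Since projfactor V W >= 0, this angle lies in [0, pi / 2].                 *)
Definition asym_angle V W : R := acos (projfactor V W).

Definition max_angle V W : R := Num.max (asym_angle V W) (asym_angle W V).

Definition min_angle V W : R := Num.min (asym_angle V W) (asym_angle W V).

Definition perp_angle V W : R := asym_angle V (orthov dot W).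

Section ExteriorAlgebra.
Variables (n : nat) (e : n.-tuple X).
Local Notation mv := (multivector R n).

(* The inclusion of X in its exterior algebra, when e is an orthonormal basis. *)
Definition mvec v : mv := \sum_i dot v (tnth e i) *: mvbasis R [set i].

Definition wedge_seq (s : seq X) : mv := \big[@wedge R n/1]_(v <- s) mvec v.

(* is_blade p A V : A is a p-blade and [A] = V.                               *)
Variant is_blade : nat -> mv -> {vspace X} -> Prop :=
  | ScalarBlade (a : R) : is_blade 0 a%:A 0%VS
  | WedgeBlade p (s : p.+1.-tuple X) : is_blade p.+1 (wedge_seq s)
      (if wedge_seq s == 0 then 0%VS else <<s>>%VS).

Lemma reorder_sign1 (i j : 'I_n) :
  reorder_sign R [set i] [set j] = if (j < i)%N then -1 else 1.
Proof.
rewrite /reorder_sign big_set1; case: ifP => ltji.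
  rewrite (bigD1 j) /= ?inE ?eqxx // big1 ?mulr1 // => k.
  by rewrite inE => /andP[/andP[->]].
by rewrite big1 // => k; rewrite inE => /andP[/eqP ->]; rewrite ltji.
Qed.

Lemma mvproduct_mvec c v w : mvproduct c (mvec v) (mvec w) =
  \sum_i \sum_j (dot v (tnth e i) * dot w (tnth e j) * c [set i] [set j])
    *: mvbasis R (symdiff [set i] [set j]).
Proof.
rewrite mvproduct_suml; apply: eq_bigr => i _.
rewrite mvproductZl mvproduct_sumr scaler_sumr; apply: eq_bigr => j _.
by rewrite mvproductZr mvproduct_basis !scalerA.
Qed.

Lemma wedge_mvecC v w : wedge (mvec v) (mvec w) = - wedge (mvec w) (mvec v).
Proof.
rewrite /wedge !mvproduct_mvec exchange_big -sumrN; apply: eq_bigr => i _.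
rewrite -sumrN; apply: eq_bigr => j _ /=; rewrite -scaleNr.
rewrite {2}/symdiff setUC disjoint_sym; congr (_ *: _).
rewrite -mulrN [dot v _ * _]mulrC; congr (_ * _).
case: ifP => [|_]; last by rewrite oppr0.
rewrite !reorder_sign1 -setI_eq0 => ij0.
have neij : i != j.
  by apply: contraTneq ij0 => ->; rewrite setIid -cards_eq0 cards1.
by case: ltngtP (neij) => [||/val_inj ->]; rewrite ?opprK ?eqxx.
Qed.

Lemma mvec_mul v w : orthonormal_basis e ->
  mvec v * mvec w = (dot v w)%:A + wedge (mvec v) (mvec w).
Proof.
case/andP=> be oe; rewrite [LHS]mvproduct_mvec /wedge mvproduct_mvec.
have vE u j : coord e j u = dot u (tnth e j).
  rewrite {2}(coord_basis be (memvf u)) dot_suml (bigD1 j) //=.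
  rewrite dotZl -tnth_nth orthonormal_dot // eqxx mulr1 big1 ?addr0 //.
  by move=> i neij; rewrite dotZl -tnth_nth orthonormal_dot // (negPf neij) mulr0.
have -> : dot v w = \sum_i dot v (tnth e i) * dot w (tnth e i).
  rewrite {1}(coord_basis be (memvf v)) dot_suml; apply: eq_bigr => i _.
  by rewrite dotZl -tnth_nth vE (dotC w).
rewrite scaler_suml -big_split; apply: eq_bigr => i _ /=.
rewrite (bigD1 i) //= [in RHS](bigD1 i) //= addrA; congr (_ + _).
  rewrite symdiffss reorder_sign1 ltnn mulr1 -setI_eq0 setIid.
  by rewrite -cards_eq0 cards1 mulr0 scale0r addr0.
apply: eq_bigr => j neji; rewrite ifT // -setI_eq0.
apply/eqP/setP=> k; rewrite !inE; case: eqP => // ->.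
by rewrite eq_sym (negPf neji).
Qed.

End ExteriorAlgebra.
End Euclidean.

Section Products.
Variables (R : realType) (n : nat).
Local Notation mv := (multivector R n).
Implicit Types (p q : nat) (A B : mv).

(* The e_S form an orthonormal basis of the exterior algebra.                *)
Definition mvnorm A : R := Num.sqrt (\sum_S A S ^+ 2).

(* In the following products A is a p-blade and B is a q-blade.               *)
Definition scalar_product A B : R := (A * B) set0.

Definition left_contraction p q A B : mv := grade (q%:Z - p%:Z) (A * B).

Definition right_contraction p q A B : mv := grade (p%:Z - q%:Z) (A * B).

Definition dot_product p q A B : mv := grade `|q%:Z - p%:Z| (A * B).

Definition hestenes_product p q A B : mv :=
  if (p != 0)%N && (q != 0)%N then grade `|q%:Z - p%:Z| (A * B) else 0.

Lemma scalar_productE A B : grade 0 (A * B) = (scalar_product A B)%:A.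
Proof.
apply/ffunP=> S; rewrite ffunE mv_scaleE mv1E mvbasisE eqz_nat cards_eq0.
by case: eqP => [->|_]; rewrite ?mulr1 ?mulr0.
Qed.

End Products.

(* Main.v *)
Require Import Defs.
From mathcomp Require Import all_boot all_order all_algebra.
From mathcomp Require Import sesquilinear.
From mathcomp Require Import reals trigo.
From mathcomp Require Import zify ring.

Set Implicit Arguments.
Unset Strict Implicit.
Unset Printing Implicit Defensive.

Import Order.TTheory GRing.Theory Num.Theory.
Local Open Scope ring_scope.

(* Left multiplication by a vector v splits as L_v = w_v + c_v, the outer     *)
(* product and the contraction by v. Operators of the same kind anticommute,  *)
(* c_u w_v + w_v c_u = u . v, and L_v multiplies norms by |v|. Let o be one   *)
(* of w, c and o' the other one, and suppose that o'_v B = 0 for all v in the *)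
(* span of s = (v_1, ..., v_p). In o_v1 ... o_vp B each v_i may be replaced   *)
(* by its component h orthogonal to the following vectors; then o'_h          *)
(* anticommutes with their operators and kills B, so that o_h acts as L_h,    *)
(* and hence the norm of this multivector is vol(s) |B|.                      *)
(* For a blade B with [B] = W, w_v B = 0 for v in W and c_v B = 0 for v in    *)
(* the orthogonal complement W'. So the factors of A may be projected on W in *)
(* the left contraction of B by A = v_1 /\ ... /\ v_p, and on W' in A /\ B.   *)
(* The norms are thus vol(P s) |B|, for the projection P on W or W'.          *)

(** The two operators are [halfprod true] and [halfprod false]. [halfprod_wedge] turns a blade
    acting on B into a composition of vector operators, [halfprod_anticomm] gives their exchange
    rules, and [mvnorm_halfprod_blade] evaluates the left contraction and the outer product at once.
    The right contraction follows by swapping the factors, since AB and BA agree up to sign on each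
    grade ([geomprodC]). If p and q differ, one contraction has negative grade and vanishes, the dot
    product is the other one, and the scalar product is 0; if p = q, all four are the grade 0 part
    of AB. So the norm of the dot product is the maximum of the two contraction norms and |A * B| is
    their minimum. As cosine decreases on [0, pi], these belong to the smaller and the larger
    angle. *)

Section HalfProducts.
Variables (R : realType) (n : nat).
Local Notation mv := (multivector R n).
Implicit Types (S T U : {set 'I_n}) (A B C M : mv) (b : bool).

(** * Reordering signs and the two halves of the geometric product *)

Lemma symdiffC S T : symdiff S T = symdiff T S.
Proof. exact: setUC. Qed.

Lemma symdiffCA S T U : symdiff S (symdiff T U) = symdiff T (symdiff S U).
Proof. by rewrite !symdiffA (symdiffC S). Qed.

Lemma symdiffKs S T : symdiff S (symdiff S T) = T.
Proof. by rewrite symdiffA symdiffss symdiff0s. Qed.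

Lemma reorder_sign_sq S T : reorder_sign R S T * reorder_sign R S T = 1.
Proof.
rewrite /reorder_sign -big_split /= big1 // => i _; exact: prodN1_sq.
Qed.

(** A pair (i, j) of S x T with i and j distinct is an inversion in exactly one of the two orders,
    and a diagonal pair in neither; this leaves |S||T| - |S cap T| factors -1. *)
Lemma reorder_signC S T :
  reorder_sign R S T * reorder_sign R T S = (-1) ^+ (#|S| * #|T| + #|S :&: T|).
Proof.
have -> : reorder_sign R T S = \prod_(i in S) \prod_(j in T | (i < j)%N) -1.
  rewrite /reorder_sign; under eq_bigr do rewrite big_mkcondr.
  by rewrite exchange_big /=; apply: eq_bigr => i _; rewrite -big_mkcondr.
rewrite /reorder_sign -big_split /=.
rewrite exprD -sum_nat_const expr_sum -[in X in _ * X]sum1_card expr_sum.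
rewrite [X in _ * X](eq_bigl (fun i => (i \in S) && (i \in T))); last first.
  by move=> i; rewrite inE.
rewrite big_mkcondr -big_split /=; apply: eq_bigr => i _.
rewrite !big_mkcondr -big_split -sum1_card expr_sum /= expr1.
have [iT|iNT] := boolP (i \in T).
  rewrite !(bigD1 i iT) /= ltnn mulr1 mul1r mulN1r mulrN1 opprK.
  apply: eq_bigr => j /andP[_ neji].
  by case: ltngtP neji => [||/val_inj ->]; rewrite ?eqxx // ?mulr1 ?mul1r.
rewrite mulr1; apply: eq_bigr => j jT.
have neji : j != i by apply: contraNneq iNT => <-.
by case: ltngtP neji => [||/val_inj ->]; rewrite ?eqxx // ?mulr1 ?mul1r.
Qed.

(* [halfprod true] is the outer product; on a p-blade and a q-blade           *)
(* [halfprod false] is the left contraction.                                  *)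
Definition halfsign b S T : R :=
  if (if b then [disjoint S & T] else S \subset T) then reorder_sign R S T else 0.

Definition halfprod b : mv -> mv -> mv := mvproduct (halfsign b).

Lemma halfprodDl b A B C : halfprod b (A + B) C = halfprod b A C + halfprod b B C.
Proof. exact: mvproductDl. Qed.

Lemma halfprodZl b a A B : halfprod b (a *: A) B = a *: halfprod b A B.
Proof. exact: mvproductZl. Qed.

Lemma halfprodZr b a A B : halfprod b A (a *: B) = a *: halfprod b A B.
Proof. exact: mvproductZr. Qed.

Lemma halfprod0r b A : halfprod b A 0 = 0.
Proof. exact: mvproduct0r. Qed.

Lemma halfprod0l b A : halfprod b 0 A = 0.
Proof. exact: mvproduct0l. Qed.

Lemma halfprod_suml b (I : Type) (r : seq I) (P : pred I) (F : I -> mv) A :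
  halfprod b (\sum_(i <- r | P i) F i) A = \sum_(i <- r | P i) halfprod b (F i) A.
Proof. exact: mvproduct_suml. Qed.

Lemma halfprod_sumr b (I : Type) (r : seq I) (P : pred I) (F : I -> mv) A :
  halfprod b A (\sum_(i <- r | P i) F i) = \sum_(i <- r | P i) halfprod b A (F i).
Proof. exact: mvproduct_sumr. Qed.

Lemma halfprod1l b : left_id 1 (halfprod b).
Proof.
apply: mvproduct1l => S; rewrite /halfsign reorder_sign0l ifT //.
by case: b; rewrite ?sub0set // -setI_eq0 set0I.
Qed.

(** For contractions, bimultiplicativity of [reorder_sign] makes the signs agree; the supports agree
    because S cap T empty and S + T inside U amounts to T inside U and S inside T + U, where + is
    symmetric difference. *)
Lemma halfprod_wedge b A B C :
  halfprod b (wedge A B) C = halfprod b A (halfprod b B C).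
Proof.
case: b; first exact/esym/wedgeA.
rewrite /halfprod /wedge (mvproduct_decompl _ A) (mvproduct_decompl _ A).
rewrite !mvproduct_suml.
apply: eq_bigr => S _; rewrite mvproductZl; congr (_ *: _).
rewrite (mvproduct_decompl _ B) (mvproduct_decompr _ _ B).
rewrite mvproduct_sumr mvproduct_suml.
apply: eq_bigr => T _; rewrite mvproductZl mvproductZr; congr (_ *: _).
rewrite (mvproduct_decompr _ _ C) [in RHS](mvproduct_decompr _ _ C) mvproduct_sumr.
apply: eq_bigr => U _; rewrite mvproductZr; congr (_ *: _).
rewrite !mvproduct_basis mvproductZr mvproductZl !mvproduct_basis !scalerA.
rewrite symdiffA; congr (_ *: _); rewrite /halfsign reorder_signDl reorder_signDr.
have -> : [disjoint S & T] = (S :&: T == set0) by rewrite setI_eq0.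
have -> : (T \subset U) = (T :\: U == set0) by rewrite setD_eq0.
have [ST|ST] := eqVneq (S :&: T) set0; last first.
  rewrite mul0r; have [/eqP TU|//] := eqVneq (T :\: U) set0; last by rewrite mul0r.
  case: ifP => [/subsetP sub|_]; last by rewrite mulr0.
  case/set0Pn: ST => i; rewrite inE => /andP[iS iT].
  move: TU; rewrite setD_eq0 => /subsetP/(_ i iT) iU.
  by have := sub i iS; rewrite in_symdiff iT iU.
have [/eqP TU|nTU] := eqVneq (T :\: U) set0; last first.
  rewrite mul0r; case: ifP => [/subsetP sub|_]; last by rewrite mulr0.
  case/set0Pn: nTU => i; rewrite inE => /andP[iU iT].
  have iS : i \notin S.
    by apply/negP=> iS; have := in_set0 i; rewrite -ST inE iS iT.
  by have := sub i; rewrite in_symdiff iT (negPf iS) (negPf iU) => /(_ isT).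
have -> : (symdiff S T \subset U) = (S \subset symdiff T U).
  move: TU; rewrite setD_eq0 => /subsetP TU.
  apply/subsetP/subsetP=> sub i.
    move=> iS; have iT : i \notin T.
      by apply/negP=> iT; have := in_set0 i; rewrite -ST inE iS iT.
    by rewrite in_symdiff (negPf iT) sub // in_symdiff iS (negPf iT).
  rewrite in_symdiff; have [iT _|iT] := boolP (i \in T); first exact: TU.
  by rewrite addbF => /sub; rewrite in_symdiff (negPf iT).
by case: ifP => _; rewrite ?mulr0 // mulrA mulrC.
Qed.

Lemma halfsign1 b (i : 'I_n) S :
  halfsign b [set i] S = if (i \in S) (+) b then reorder_sign R [set i] S else 0.
Proof.
rewrite /halfsign disjoints1 sub1set.
by case: b; case: (i \in S).
Qed.

(** If i and j differ, toggling one leaves the membership test of the other unchanged, and the two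
    orders have opposite signs. If i = j, toggling flips the test: equal kinds kill both terms,
    different kinds leave exactly one, a squared sign. *)
Lemma halfsign_anticomm b b' (i j : 'I_n) S :
  halfsign b [set i] (symdiff [set j] S) * halfsign b' [set j] S
   + halfsign b' [set j] (symdiff [set i] S) * halfsign b [set i] S
  = ((b != b') && (i == j))%:R.
Proof.
rewrite !halfsign1 !reorder_signDr !in_symdiff !inE !reorder_sign1.
have [->|neij] := eqVneq i j.
  rewrite ?eqxx ltnn mul1r; have sq := reorder_sign_sq [set j] S.
  by case: b; case: b'; case: (j \in S); rewrite /= ?mulr0 ?mul0r ?addr0 ?add0r.
rewrite ?[j == i]eq_sym ?(negPf neij) andbF /=.
case: (_ (+) b); case: (_ (+) b'); rewrite ?mulr0 ?mul0r ?addr0 //.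
set x := reorder_sign _ _ _; set y := reorder_sign _ _ _.
have [||/val_inj E] := ltngtP j i; last by rewrite E eqxx in neij.
  by move=> _; rewrite mulN1r mul1r mulNr mulrC addrC subrr.
by move=> _; rewrite mulN1r mul1r mulNr mulrC subrr.
Qed.

Lemma halfprod_basis_anticomm b b' (i j : 'I_n) M :
  halfprod b (mvbasis R [set i]) (halfprod b' (mvbasis R [set j]) M)
   + halfprod b' (mvbasis R [set j]) (halfprod b (mvbasis R [set i]) M)
  = ((b != b') && (i == j))%:R *: M.
Proof.
rewrite {1 2}(mv_decomp M) [in RHS](mv_decomp M) (halfprod_sumr b') (halfprod_sumr b).
rewrite (halfprod_sumr b) (halfprod_sumr b') -big_split scaler_sumr.
apply: eq_bigr => S _ /=; rewrite !halfprodZr -scalerDr [RHS]scalerA mulrC -scalerA.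
congr (_ *: _); rewrite /halfprod !mvproduct_basis !mvproductZr !mvproduct_basis.
rewrite !scalerA (symdiffCA [set j]) -scalerDl.
rewrite [X in X + _]mulrC [X in _ + X]mulrC halfsign_anticomm.
have [->|_] := eqVneq i j; last by rewrite andbF !scale0r.
by rewrite symdiffKs.
Qed.

Lemma halfprod_basisD (i : 'I_n) M :
  mvbasis R [set i] * M = halfprod true (mvbasis R [set i]) M
                          + halfprod false (mvbasis R [set i]) M.
Proof.
rewrite [LHS]mvproduct_decompr (mv_decomp M) !halfprod_sumr -big_split -mv_decomp.
apply: eq_bigr => S _ /=; rewrite !halfprodZr -scalerDr; congr (_ *: _).
rewrite /halfprod !mvproduct_basis -scalerDl; congr (_ *: _).
by rewrite !halfsign1; case: (i \in S); rewrite /= ?addr0 ?add0r.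
Qed.

Definition mvdot A B : R := \sum_S A S * B S.

Lemma mul_basisE S A T :
  (mvbasis R S * A) T = reorder_sign R S (symdiff S T) * A (symdiff S T).
Proof.
rewrite [mvbasis R S * A]mvproduct_decompr sum_ffunE (bigD1 (symdiff S T)) //=.
rewrite big1 ?addr0 => [|U neU]; rewrite mvproduct_basis !mv_scaleE mvbasisE.
  by rewrite symdiffKs eqxx mulr1 mulrC.
case: eqP => [E|_]; last by rewrite !mulr0.
by rewrite E symdiffKs eqxx in neU.
Qed.

Lemma mvdotDl A B C : mvdot (A + B) C = mvdot A C + mvdot B C.
Proof. by rewrite -big_split; apply: eq_bigr => S _; rewrite ffunE mulrDl. Qed.

Lemma mvdotC A B : mvdot A B = mvdot B A.
Proof. by apply: eq_bigr => S _; rewrite mulrC. Qed.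

Lemma mvdotZl a A B : mvdot (a *: A) B = a * mvdot A B.
Proof. by rewrite mulr_sumr; apply: eq_bigr => S _; rewrite mv_scaleE mulrA. Qed.

Lemma mvdotZr a A B : mvdot A (a *: B) = a * mvdot A B.
Proof. by rewrite mvdotC mvdotZl mvdotC. Qed.

Lemma mvdot_suml (I : Type) (r : seq I) (P : pred I) (F : I -> mv) A :
  mvdot (\sum_(i <- r | P i) F i) A = \sum_(i <- r | P i) mvdot (F i) A.
Proof.
apply: (big_morph (mvdot^~ A)) => [B C|]; first exact: mvdotDl.
by rewrite /mvdot big1 // => S _; rewrite ffunE mul0r.
Qed.

(** Left multiplication by e_i is an involution permuting the e_S up to sign, hence self-adjoint. *)
Lemma mvdot_mul_basis (i : 'I_n) A B :
  mvdot (mvbasis R [set i] * A) B = mvdot A (mvbasis R [set i] * B).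
Proof.
rewrite /mvdot (reindex_inj (inv_inj (symdiffKs [set i]))) /=.
apply: eq_bigr => S _; rewrite !mul_basisE symdiffKs reorder_signDr reorder_sign1.
by rewrite ltnn mul1r -mulrA mulrCA.
Qed.

End HalfProducts.

(** * Volume as the norm of iterated half products *)

Section HalfVolume.
Variables (R : realType) (X : vectType R) (dot : {dot X for idfun}).
Variables (n : nat) (e : n.-tuple X).
Hypothesis he : orthonormal_basis dot e.
Local Notation mv := (multivector R n).
Local Notation mvec := (mvec dot e).
Local Notation wedge_seq := (wedge_seq dot e).
Implicit Types (u v w : X) (A B M : mv) (b : bool) (s t : seq X).

Lemma dot_parseval v w :
  dot v w = \sum_i dot v (tnth e i) * dot w (tnth e i).
Proof.
case/andP: he => be oe.
have vE u j : coord e j u = dot u (tnth e j).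
  rewrite {2}(coord_basis be (memvf u)) dot_suml (bigD1 j) //=.
  rewrite dotZl -tnth_nth orthonormal_dot // eqxx mulr1 big1 ?addr0 //.
  by move=> i neij; rewrite dotZl -tnth_nth orthonormal_dot // (negPf neij) mulr0.
rewrite {1}(coord_basis be (memvf v)) dot_suml; apply: eq_bigr => i _.
by rewrite dotZl -tnth_nth vE (dotC dot w).
Qed.

Lemma mvecD u v : mvec (u + v) = mvec u + mvec v.
Proof.
by rewrite -big_split; apply: eq_bigr => i _; rewrite dotDl scalerDl.
Qed.

Lemma mvecZ a v : mvec (a *: v) = a *: mvec v.
Proof. by rewrite scaler_sumr; apply: eq_bigr => i _; rewrite dotZl scalerA. Qed.

Lemma mvec_sum (I : Type) (r : seq I) (P : pred I) (F : I -> X) :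
  mvec (\sum_(i <- r | P i) F i) = \sum_(i <- r | P i) mvec (F i).
Proof.
apply: (big_morph mvec mvecD).
by rewrite /Defs.mvec big1 // => i _; rewrite linear0l scale0r.
Qed.

Lemma mvec_mull v M :
  mvec v * M = halfprod true (mvec v) M + halfprod false (mvec v) M.
Proof.
rewrite mulr_suml !halfprod_suml -big_split; apply: eq_bigr => i _ /=.
by rewrite -scalerAl !halfprodZl -scalerDr halfprod_basisD.
Qed.

Lemma halfprod_anticomm b b' u v M :
  halfprod b (mvec u) (halfprod b' (mvec v) M)
   + halfprod b' (mvec v) (halfprod b (mvec u) M)
  = ((b != b')%:R * dot u v) *: M.
Proof.
pose E i := mvbasis R [set i] : mv.
have H c c' x y : halfprod c (mvec x) (halfprod c' (mvec y) M) =
    \sum_i \sum_j (dot x (tnth e i) * dot y (tnth e j))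
      *: halfprod c (E i) (halfprod c' (E j) M).
  rewrite (halfprod_suml c); apply: eq_bigr => i _.
  rewrite (halfprod_suml c') halfprodZl (halfprod_sumr c) scaler_sumr.
  by apply: eq_bigr => j _; rewrite halfprodZl halfprodZr scalerA.
rewrite !H [X in _ + X]exchange_big -big_split dot_parseval mulr_sumr scaler_suml.
apply: eq_bigr => i _ /=; rewrite -big_split (bigD1 i) //= big1 => [|j neji].
  rewrite [X in _ + X *: _]mulrC -scalerDr halfprod_basis_anticomm eqxx andbT addr0.
  by rewrite scalerA mulrC.
rewrite [X in _ + X *: _]mulrC -scalerDr halfprod_basis_anticomm.
by rewrite [i == j]eq_sym (negPf neji) andbF scale0r scaler0.
Qed.

Lemma halfprod_sq0 b v M : halfprod b (mvec v) (halfprod b (mvec v) M) = 0.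
Proof.
have := halfprod_anticomm b b v v M; rewrite eqxx mul0r scale0r -mulr2n.
by move/eqP; rewrite -scaler_nat scaler_eq0 pnatr_eq0 => /eqP.
Qed.

Lemma mvec_sqr v : mvec v * mvec v = (dot v v)%:A.
Proof.
rewrite mvec_mul //; have := halfprod_sq0 true v 1.
by rewrite [halfprod true _ 1]wedge1r => vv; rewrite [wedge _ _]vv addr0.
Qed.

Lemma mvdot_mvec v A B : mvdot (mvec v * A) B = mvdot A (mvec v * B).
Proof.
rewrite [RHS]mvdotC !mulr_suml !mvdot_suml; apply: eq_bigr => i _.
by rewrite -!scalerAl !mvdotZl mvdot_mul_basis [in RHS]mvdotC.
Qed.

Lemma mvnormE A : mvnorm A = Num.sqrt (mvdot A A).
Proof. by congr Num.sqrt; apply: eq_bigr => S _; rewrite expr2. Qed.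

Lemma mvnormZ a A : mvnorm (a *: A) = `|a| * mvnorm A.
Proof.
by rewrite !mvnormE mvdotZl mvdotZr mulrA -expr2 sqrtrM ?sqr_ge0 // sqrtr_sqr.
Qed.

Lemma mvnorm0 : mvnorm (0 : mv) = 0.
Proof. by rewrite -(scale0r (0 : mv)) mvnormZ normr0 mul0r. Qed.

Lemma mvnorm1 : mvnorm (1 : mv) = 1.
Proof.
rewrite /mvnorm mv1E (bigD1 set0) //= big1 => [|S neS]; rewrite mvbasisE.
  by rewrite eqxx expr1n addr0 sqrtr1.
by rewrite (negPf neS) expr0n.
Qed.

(** Left multiplication by a vector is self-adjoint and its square is the scalar v . v. *)
Lemma mvnorm_mvec_mul v A : mvnorm (mvec v * A) = Num.sqrt (dot v v) * mvnorm A.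
Proof.
rewrite !mvnormE mvdot_mvec mulrA mvec_sqr -scalerAl mul1r mvdotZr.
by rewrite sqrtrM ?dot_ge0.
Qed.

Lemma wedge_seq_nil : wedge_seq [::] = 1.
Proof. by rewrite /Defs.wedge_seq big_nil. Qed.

Lemma wedge_seq_cons v s : wedge_seq (v :: s) = wedge (mvec v) (wedge_seq s).
Proof. by rewrite /Defs.wedge_seq big_cons. Qed.

Lemma halfprod_seq_cons b v s B : halfprod b (wedge_seq (v :: s)) B
  = halfprod b (mvec v) (halfprod b (wedge_seq s) B).
Proof. by rewrite wedge_seq_cons halfprod_wedge. Qed.

(** The operator of u is moved through those of s until it meets B; each exchange costs a multiple
    of u . v, and only when the kinds differ. *)
Lemma halfprod_seq_eq0 b b' u s B :
    (b != b' -> forall v, v \in s -> dot u v = 0) ->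
  halfprod b (mvec u) B = 0 ->
  halfprod b (mvec u) (halfprod b' (wedge_seq s) B) = 0.
Proof.
move=> us uB; elim: s us => [|v s IHs] us.
  by rewrite wedge_seq_nil halfprod1l.
have := halfprod_anticomm b b' u v (halfprod b' (wedge_seq s) B).
rewrite -halfprod_seq_cons IHs => [|neb w ws]; last first.
  by apply: us; rewrite // inE ws orbT.
rewrite halfprod0r addr0 => ->; case: (b != b') us => [/(_ isT) us|_].
  by rewrite us ?mem_head // mulr0 scale0r.
by rewrite mul0r scale0r.
Qed.

Lemma halfprod_span_eq0 b u s B : u \in <<s>>%VS ->
  halfprod b (mvec u) (halfprod b (wedge_seq s) B) = 0.
Proof.
have mem v : v \in s -> halfprod b (mvec v) (halfprod b (wedge_seq s) B) = 0.
  elim: s => // w s IHs; rewrite inE halfprod_seq_cons.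
  have [->|_ /= /IHs vs] := eqVneq v w; first by rewrite halfprod_sq0.
  have := halfprod_anticomm b b v w (halfprod b (wedge_seq s) B).
  by rewrite vs halfprod0r addr0 eqxx mul0r scale0r.
move=> us; rewrite (@coord_span _ _ _ (in_tuple s) u us).
rewrite mvec_sum halfprod_suml big1 // => i _.
by rewrite mvecZ halfprodZl mem ?scaler0 // mem_nth.
Qed.

(** The operator of v - P v anticommutes with the others, all of the same kind, and so reaches B and
    kills it. *)
Lemma halfprod_seq_map b (P : X -> X) s B :
    (forall v, v \in s -> halfprod b (mvec (v - P v)) B = 0) ->
  halfprod b (wedge_seq s) B = halfprod b (wedge_seq (map P s)) B.
Proof.
elim: s => // v s IHs sP; rewrite !halfprod_seq_cons IHs; last first.
  by move=> w ws; rewrite sP // inE ws orbT.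
rewrite -{1}(subrK (P v) v) mvecD halfprodDl halfprod_seq_eq0 ?add0r ?eqxx //.
by rewrite sP ?mem_head.
Qed.

Lemma mvnorm_halfprod_seq b p (s : p.-tuple X) B :
    (forall v, v \in <<s>>%VS -> halfprod (~~ b) (mvec v) B = 0) ->
  mvnorm (halfprod b (wedge_seq s) B) = volume dot s * mvnorm B.
Proof.
elim: p s => [|p IHp] s.
  by rewrite tuple0 wedge_seq_nil halfprod1l volume0 mul1r.
case/tupleP: s => v s sB; rewrite volume_cons -mulrA -IHp; last first.
  by move=> u us; apply: sB; rewrite span_cons -[u]add0r memv_add ?mem0v.
set M := halfprod b (wedge_seq s) B; pose u := orthoproj dot <<s>> v.
have [us hs] := orthoprojP dot <<s>> v; rewrite -/u in us hs *.
(* The component u in the span of the tail contributes nothing; for the height v - u the opposite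
   half vanishes on M, so the remaining half is the full geometric product. *)
have -> : halfprod b (wedge_seq [tuple of v :: s]) B = mvec (v - u) * M.
  rewrite halfprod_seq_cons -/M -{1}(subrK u v) (mvecD _ u) halfprodDl.
  rewrite [X in _ + X]halfprod_span_eq0 // addr0 mvec_mull.
  suff N0 : halfprod (~~ b) (mvec (v - u)) M = 0.
    by case: b {IHp} @M sB N0 => M sB /= ->; rewrite ?addr0 ?add0r.
  apply: halfprod_seq_eq0 => [_ w ws|].
    by move/mem_orthovP: hs; apply; rewrite memv_span.
  apply: sB; rewrite span_cons memv_add ?memv_line //.
  by rewrite memvN.
exact: mvnorm_mvec_mul.
Qed.

End HalfVolume.

(** * Grades, and exchanging the factors *)

Section Grades.
Variables (R : realType) (n : nat).
Local Notation mv := (multivector R n).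
Implicit Types (S T U : {set 'I_n}) (A B : mv) (p q : nat) (k : int).

Lemma symdiffsK S T : symdiff (symdiff S T) T = S.
Proof. by rewrite -symdiffA symdiffss symdiffs0. Qed.

Lemma mvproductE (c : {set 'I_n} -> {set 'I_n} -> R) A B U :
  mvproduct c A B U = \sum_S c S (symdiff S U) * (A S * B (symdiff S U)).
Proof.
rewrite sum_ffunE; apply: eq_bigr => S _; rewrite sum_ffunE.
rewrite (bigD1 (symdiff S U)) //= big1 ?addr0 => [|T neT].
  by rewrite mv_scaleE mvbasisE symdiffKs eqxx mulr1.
rewrite mv_scaleE mvbasisE; case: eqP => [E|_]; last by rewrite mulr0.
by rewrite E symdiffKs eqxx in neT.
Qed.

Lemma geomprodE A B U :
  (A * B) U = \sum_S reorder_sign R S (symdiff S U) * (A S * B (symdiff S U)).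
Proof. exact: mvproductE. Qed.

Lemma grade_id k A : grade k (grade k A) = grade k A.
Proof. by apply/ffunP=> S; rewrite !ffunE; case: ifP => // ->. Qed.

Lemma gradeZ k a A : grade k (a *: A) = a *: grade k A.
Proof.
by apply/ffunP=> S; rewrite !(mv_scaleE, ffunE); case: ifP; rewrite // mulr0.
Qed.

Lemma grade_eq0 p A S : grade p%:Z A = A -> #|S| != p -> A S = 0.
Proof. by move=> <-; rewrite ffunE eqz_nat => /negPf ->. Qed.

Lemma grade1 : grade 0%:Z 1 = 1 :> mv.
Proof.
apply/ffunP=> S; rewrite ffunE mv1E mvbasisE eqz_nat cards_eq0.
by case: eqP.
Qed.

Lemma card_symdiff_homog p q A B S U : grade p%:Z A = A -> grade q%:Z B = B ->
  A S * B (symdiff S U) != 0 ->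
  [/\ #|S| = p, #|symdiff S U| = q
    & (#|U| + (#|S :&: symdiff S U|).*2 = p + q)%N].
Proof.
move=> Ap Bq; have [Sp|/(grade_eq0 Ap)->] := eqVneq #|S| p; last first.
  by rewrite mul0r eqxx.
have [Tq|/(grade_eq0 Bq)->] := eqVneq #|symdiff S U| q; last first.
  by rewrite mulr0 eqxx.
by move=> _; split; rewrite // -Sp -Tq -card_symdiff symdiffKs.
Qed.

(** The grade of e_S e_T is p + q - 2|S cap T|, which equals q - p exactly when |S cap T| = p, that
    is, when S is contained in T. *)
Lemma contraction_grade p q A B : grade p%:Z A = A -> grade q%:Z B = B ->
  halfprod false A B = left_contraction p q A B.
Proof.
move=> Ap Bq; apply/ffunP=> U; rewrite ffunE geomprodE mvproductE.
rewrite (_ : (if _ then _ else 0) = \sum_S (if #|U|%:Z == q%:Z - p%:Z then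
  reorder_sign R S (symdiff S U) * (A S * B (symdiff S U)) else 0)); last first.
  by case: ifP => // _; rewrite big1.
apply: eq_bigr => S _.
have [->|/(card_symdiff_homog Ap Bq)[Sp Tq UE]] :=
  eqVneq (A S * B (symdiff S U)) 0; first by rewrite !mulr0 if_same.
suff -> : (#|U|%:Z == q%:Z - p%:Z) = (S \subset symdiff S U).
  by rewrite /halfsign; case: ifP; rewrite ?mul0r.
rewrite eq_sym subr_eq eq_sym -PoszD eqz_nat (sameP setIidPl eqP).
have := subset_leqif_cards (subsetIl S (symdiff S U)) => /leqifP.
by case: eqP => _ /eqP; lia.
Qed.

(* For homogeneous A and B the parity of the swap e_S e_T -> e_T e_S only     *)
(* depends on the grades, since |S cap T| = (p + q - |S symdiff T|) / 2.      *)
Lemma geomprodC p q A B U : grade p%:Z A = A -> grade q%:Z B = B ->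
  (B * A) U = (-1) ^+ (p * q + (p + q - #|U|)./2) * (A * B) U.
Proof.
move=> Ap Bq; rewrite !geomprodE.
have symK : involutive (fun S => symdiff S U) by move=> S; exact: symdiffsK.
rewrite [LHS](reindex_inj (inv_inj symK)) mulr_sumr /=.
apply: eq_bigr => S _; rewrite symdiffsK [B _ * _]mulrC.
have [->|/(card_symdiff_homog Ap Bq)[Sp Tq UE]] :=
  eqVneq (A S * B (symdiff S U)) 0; first by rewrite !mulr0.
rewrite [RHS]mulrA; congr (_ * _); rewrite -[LHS]mul1r.
rewrite -{1}(reorder_sign_sq R S (symdiff S U)) -mulrA mulrC reorder_signC Sp Tq.
by rewrite -UE addKn doubleK.
Qed.

Lemma mvnorm_grade_mulC p q k A B : grade p%:Z A = A -> grade q%:Z B = B ->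
  mvnorm (grade k (A * B)) = mvnorm (grade k (B * A)).
Proof.
move=> Ap Bq; congr Num.sqrt; apply: eq_bigr => U _; rewrite !ffunE.
case: ifP => // _; rewrite (geomprodC U Ap Bq) exprMn -exprM mulnC exprM.
by rewrite sqrrN !expr1n mul1r.
Qed.

Lemma mvnorm_right_contraction p q A B : grade p%:Z A = A -> grade q%:Z B = B ->
  mvnorm (right_contraction p q A B) = mvnorm (left_contraction q p B A).
Proof. exact: mvnorm_grade_mulC. Qed.

Lemma scalar_product_neq p q A B : grade p%:Z A = A -> grade q%:Z B = B ->
  p != q -> scalar_product A B = 0.
Proof.
move=> Ap Bq nepq; rewrite /scalar_product geomprodE big1 // => S _.
have [->|/(card_symdiff_homog Ap Bq)[Sp Tq _]] :=
  eqVneq (A S * B (symdiff S set0)) 0; first by rewrite mulr0.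
by rewrite symdiffs0 Sp in Tq; rewrite Tq eqxx in nepq.
Qed.

Lemma mvnorm_grade0 A B : mvnorm (grade 0 (A * B)) = `|scalar_product A B|.
Proof. by rewrite scalar_productE mvnormZ mvnorm1 mulr1. Qed.

Lemma grade_lt0 k A : k < 0 -> grade k A = 0.
Proof.
move=> k0; apply/ffunP=> S; rewrite !ffunE; case: eqP => // E.
by move: k0; rewrite -E ltz_nat.
Qed.

Lemma left_contraction_lt p q A B : (q < p)%N -> left_contraction p q A B = 0.
Proof. by move=> ltqp; rewrite /left_contraction grade_lt0 // subr_lt0. Qed.

Lemma right_contraction_lt p q A B : (p < q)%N -> right_contraction p q A B = 0.
Proof. by move=> ltpq; rewrite /right_contraction grade_lt0 // subr_lt0. Qed.

End Grades.

(** * Projection factors and cosines of the angles *)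

Section Projections.
Variables (R : realType) (X : vectType R) (dot : {dot X for idfun}).
Implicit Types (u v w : X) (V W : {vspace X}).
Local Notation proj := (orthoproj dot).

Lemma dot_pythagoras_le u v : dot u v = 0 -> dot u u <= dot (u + v) (u + v).
Proof.
move=> uv; rewrite dotDl !dotDr uv (dotC dot v u) uv addr0 add0r.
by rewrite lerDl dot_ge0.
Qed.

Lemma orthoproj_min W v w : w \in W ->
  dot (v - proj W v) (v - proj W v) <= dot (v - w) (v - w).
Proof.
move=> wW; have [pW /mem_orthovP hW] := orthoprojP dot W v.
rewrite -[v - w](subrKA (proj W v)); apply: dot_pythagoras_le.
by apply: hW; rewrite memvB.
Qed.

Lemma orthoproj_contract W v : dot (proj W v) (proj W v) <= dot v v.
Proof.
have [pW /mem_orthovP hW] := orthoprojP dot W v.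
rewrite -{3 4}[v](subrK (proj W v)) addrC; apply: dot_pythagoras_le.
by rewrite dotC; apply: hW.
Qed.

(** The residual of v is orthogonal both to v and to its projection, hence to itself. This serves
    the outer product, where the projection is onto the complement of W. *)
Lemma orthovK_sub W : (orthov dot (orthov dot W) <= W)%VS.
Proof.
apply/subvP=> v /mem_orthovP vW; have [pW hW] := orthoprojP dot W v.
suff /eqP : dot (v - proj W v) (v - proj W v) = 0.
  by rewrite dot_eq0 subr_eq0 => /eqP ->.
rewrite {1}linearBl /= vW // dotC; move/mem_orthovP: hW => -> //.
by rewrite subrr.
Qed.

(** This bounds projection factors by 1, so that [cos] undoes [acos] in [asym_angle]. *)
Lemma volume_orthoproj_le W p (s : p.-tuple X) :
  volume dot (map_tuple (proj W) s) <= volume dot s.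
Proof.
elim: p s => [|p IHp] s; first by rewrite !volume0.
case/tupleP: s => v s.
have -> : map_tuple (proj W) [tuple of v :: s]
  = [tuple of proj W v :: map_tuple (proj W) s] by apply: val_inj.
rewrite !volume_cons; apply: ler_pM; rewrite ?sqrtr_ge0 //.
rewrite ler_sqrt ?dot_ge0 //.
(* The image of the height is P v minus a vector in the span of P s: it is at least the height of P
   v, and at most the height of v. *)
apply: le_trans (orthoproj_contract W (v - proj <<s>> v)).
rewrite (linearB (proj W)) /=; apply: orthoproj_min.
have [/coord_span -> _] := orthoprojP dot <<s>> v.
rewrite linear_sum; apply: memv_suml => i _ /=; rewrite linearZ memvZ //.
by rewrite memv_span // map_f // mem_nth ?size_tuple.
Qed.

Lemma projfactor_ge0 V W : 0 <= projfactor dot V W.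
Proof. by rewrite divr_ge0 ?sqrtr_ge0. Qed.

Lemma projfactor_le1 V W : projfactor dot V W <= 1.
Proof.
rewrite /projfactor ler_pdivrMr ?mul1r ?volume_orthoproj_le //.
exact/volume_gt0/basis_free/vbasisP.
Qed.

Lemma projfactor_itv V W : -1 <= projfactor dot V W <= 1.
Proof.
by rewrite projfactor_le1 (le_trans _ (projfactor_ge0 V W)) // oppr_le0 ler01.
Qed.

Lemma cos_asym_angle V W : cos (asym_angle dot V W) = projfactor dot V W.
Proof. by rewrite /asym_angle acosK // in_itv /= projfactor_itv. Qed.

Lemma asym_angle_itv V W : asym_angle dot V W \in `[0, pi].
Proof. by rewrite in_itv /= acos_ge0 ?acos_lepi ?projfactor_itv. Qed.

Lemma asym_angle_lt V W V' W' : (asym_angle dot V W < asym_angle dot V' W')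
  = (projfactor dot V' W' < projfactor dot V W).
Proof. by rewrite -!cos_asym_angle ltr_cos ?asym_angle_itv. Qed.

Lemma cos_max_angle V W :
  cos (max_angle dot V W) = Num.min (projfactor dot W V) (projfactor dot V W).
Proof.
by rewrite /max_angle /Order.max /Order.min asym_angle_lt; case: ifP;
  rewrite cos_asym_angle.
Qed.

Lemma cos_min_angle V W :
  cos (min_angle dot V W) = Num.max (projfactor dot W V) (projfactor dot V W).
Proof.
by rewrite /min_angle /Order.max /Order.min asym_angle_lt; case: ifP;
  rewrite cos_asym_angle.
Qed.

Lemma projfactor_basis p (s : p.-tuple X) V W : basis_of V s ->
  projfactor dot V W = volume dot (map_tuple (proj W) s) / volume dot s.
Proof.
move=> bs; have E := size_basis bs; subst p; exact: projfactorE.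
Qed.

End Projections.

(** * Blades and the norms of their products *)

Section Blades.
Variables (R : realType) (X : vectType R) (dot : {dot X for idfun}).
Variables (n : nat) (e : n.-tuple X).
Hypothesis he : orthonormal_basis dot e.
Local Notation mv := (multivector R n).
Local Notation mvec := (mvec dot e).
Local Notation wedge_seq := (wedge_seq dot e).
Local Notation is_blade := (is_blade dot e).
Implicit Types (v w : X) (A B : mv) (V W U : {vspace X}).

Lemma mvec_grade v : grade 1%:Z (mvec v) = mvec v.
Proof.
apply/ffunP=> S; rewrite ffunE sum_ffunE; case: ifP => // /negbT S1.
rewrite big1 // => i _; rewrite mv_scaleE mvbasisE.
by have [E|_] := eqVneq S [set i]; [rewrite E cards1 eqxx in S1 | rewrite mulr0].
Qed.

Lemma wedge_seq_grade (s : seq X) : grade (size s)%:Z (wedge_seq s) = wedge_seq s.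
Proof.
elim: s => [|v s IHs]; first by rewrite wedge_seq_nil grade1.
by rewrite wedge_seq_cons (wedge_grade (mvec_grade v) IHs) grade_id.
Qed.

Lemma contraction_vec1 v : halfprod false (mvec v) 1 = 0.
Proof.
rewrite halfprod_suml big1 // => i _; rewrite halfprodZl [halfprod _ _ _]mvproduct_basis.
by rewrite halfsign1 inE scale0r scaler0.
Qed.

Lemma mvnorm_wedge_seq p (s : p.-tuple X) : mvnorm (wedge_seq s) = volume dot s.
Proof.
have := mvnorm_halfprod_seq he (b := true) (s := s) (B := 1).
rewrite mvnorm1 mulr1 [halfprod _ _ _]wedge1r; apply=> v _.
exact: contraction_vec1.
Qed.

Lemma wedge_span_eq0 v (s : seq X) : v \in <<s>>%VS ->
  wedge (mvec v) (wedge_seq s) = 0.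
Proof.
move=> vs; rewrite -[wedge_seq s]wedge1r.
exact: (halfprod_span_eq0 he true).
Qed.

Lemma contraction_orthov_eq0 v (s : seq X) : v \in orthov dot <<s>> ->
  halfprod false (mvec v) (wedge_seq s) = 0.
Proof.
move/mem_orthovP=> vs; rewrite -[wedge_seq s]wedge1r.
apply: (halfprod_seq_eq0 he (b' := true)); last exact: contraction_vec1.
by move=> _ w ws; rewrite vs ?memv_span.
Qed.

Lemma wedge_seq_free (s : seq X) : wedge_seq s != 0 -> free s.
Proof.
elim: s => [|v s IHs]; first by rewrite nil_free.
rewrite wedge_seq_cons free_cons => nz; rewrite IHs.
  by rewrite andbT; apply: contraNN nz => /wedge_span_eq0 ->.
by apply: contraNneq nz => ->; rewrite [wedge _ _](halfprod0r true).
Qed.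

(** A common form for scalars and outer products: a scalar is a multiple of the empty outer product,
    and the empty tuple is a basis of {0}. The basis claim needs A nonzero, since [0] = {0} whatever
    the span of s. *)
Lemma is_blade_seq p A V : is_blade p A V ->
  exists a (s : p.-tuple X), A = a *: wedge_seq s /\ (A != 0 -> basis_of V s).
Proof.
case=> [a|{}p s].
  exists a, [tuple]; rewrite wedge_seq_nil; split=> // _.
  by rewrite basisEdim span_nil sub0v dimv0.
exists 1, s; rewrite scale1r; split=> // nz.
by rewrite (negPf nz) basisEfree wedge_seq_free // subvv dim_span.
Qed.

Lemma blade_grade p A V : is_blade p A V -> grade p%:Z A = A.
Proof.
case/is_blade_seq=> a [s [-> _]].
by rewrite gradeZ -{1}(size_tuple s) wedge_seq_grade.
Qed.

(** U will be [B] for the contraction and its orthogonal complement for the outer product. *)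
Lemma mvnorm_halfprod_blade b p A V U B : is_blade p A V ->
    {in orthov dot U, forall v, halfprod b (mvec v) B = 0} ->
    {in U, forall v, halfprod (~~ b) (mvec v) B = 0} ->
  mvnorm (halfprod b A B) = mvnorm A * mvnorm B * projfactor dot V U.
Proof.
case/is_blade_seq=> a [s [AE bV]] hb hNb.
have [->|/bV{}bV] := eqVneq A 0; first by rewrite halfprod0l mvnorm0 !mul0r.
rewrite AE halfprodZl !mvnormZ mvnorm_wedge_seq (projfactor_basis _ _ bV).
rewrite (halfprod_seq_map he (P := orthoproj dot U)); last first.
  by move=> v _; apply: hb; case: (orthoprojP dot U v).
have := mvnorm_halfprod_seq he (b := b) (s := map_tuple (orthoproj dot U) s) (B := B).
move=> ->; last first.
  move=> v vPs; apply: hNb; apply: subvP vPs => //; apply/span_subvP.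
  by move=> _ /mapP[w _ ->]; case: (orthoprojP dot U w).
(* The norm of A is |a| times this volume, which cancels the denominator of the projection
   factor. *)
have : volume dot s != 0 by rewrite gt_eqF ?volume_gt0 ?(basis_free bV).
by move=> nz; field.
Qed.

Lemma mvnorm_left_contraction p q A B V W :
  is_blade p A V -> is_blade q B W ->
  mvnorm (left_contraction p q A B) = mvnorm A * mvnorm B * projfactor dot V W.
Proof.
move=> hA hB; rewrite -(contraction_grade (blade_grade hA) (blade_grade hB)).
have [->|B0] := eqVneq B 0; first by rewrite halfprod0r mvnorm0 mulr0 mul0r.
case/is_blade_seq: hB => b [t [BE /(_ B0) /span_basis <-]].
apply: (mvnorm_halfprod_blade hA) => v vW; rewrite BE halfprodZr.
  by rewrite contraction_orthov_eq0 ?scaler0.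
by rewrite [halfprod _ _ _](wedge_span_eq0 vW) scaler0.
Qed.

Lemma mvnorm_wedge p q A B V W : is_blade p A V -> is_blade q B W ->
  mvnorm (wedge A B) = mvnorm A * mvnorm B * projfactor dot V (orthov dot W).
Proof.
move=> hA hB.
have [->|B0] := eqVneq B 0.
  by rewrite [wedge _ _](halfprod0r true) mvnorm0 mulr0 mul0r.
case/is_blade_seq: hB => b [t [BE /(_ B0) /span_basis <-]].
apply: (mvnorm_halfprod_blade (b := true) hA) => v vW; rewrite BE halfprodZr.
  have vt := subvP (orthovK_sub dot <<t>>) _ vW.
  by rewrite [halfprod _ _ _](wedge_span_eq0 vt) scaler0.
by rewrite contraction_orthov_eq0 ?scaler0.
Qed.

End Blades.

Theorem theorem5p2 (R : realType) (X : vectType R) (dot : {dot X for idfun})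
    (n : nat) (e : n.-tuple X) (he : orthonormal_basis dot e)
    (p q : nat) (A B : multivector R n) (V W : {vspace X})
    (hA : is_blade dot e p A V) (hB : is_blade dot e q B W) :
  `|scalar_product A B|
    = mvnorm A * mvnorm B * cos (max_angle dot V W) /\
  mvnorm (left_contraction p q A B)
    = mvnorm A * mvnorm B * cos (asym_angle dot V W) /\
  mvnorm (right_contraction p q A B)
    = mvnorm A * mvnorm B * cos (asym_angle dot W V) /\
  mvnorm (dot_product p q A B)
    = mvnorm A * mvnorm B * cos (min_angle dot V W) /\
  (p <> 0%N -> q <> 0%N ->
     mvnorm (hestenes_product p q A B)
       = mvnorm A * mvnorm B * cos (min_angle dot V W)) /\
  mvnorm (wedge A B)
    = mvnorm A * mvnorm B * cos (perp_angle dot V W).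
Proof.
have gA := blade_grade he hA; have gB := blade_grade he hB.
have L := mvnorm_left_contraction he hA hB.
have M : mvnorm (right_contraction p q A B)
    = mvnorm A * mvnorm B * projfactor dot W V.
  rewrite (mvnorm_right_contraction gA gB) (mvnorm_left_contraction he hB hA).
  by rewrite (mulrC (mvnorm B)).
have nAB : 0 <= mvnorm A * mvnorm B by rewrite mulr_ge0 ?sqrtr_ge0.
have Lge0 : 0 <= mvnorm (left_contraction p q A B) by exact: sqrtr_ge0.
have Mge0 : 0 <= mvnorm (right_contraction p q A B) by exact: sqrtr_ge0.
(* The maximum selects the contraction of nonnegative grade, the other one being 0. *)
have D : mvnorm (dot_product p q A B)
    = mvnorm A * mvnorm B * cos (min_angle dot V W).
  rewrite cos_min_angle maxr_pMr // -L -M /dot_product.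
  have [ltpq|ltqp|->] := ltngtP p q.
  - rewrite ger0_norm ?subr_ge0 ?lez_nat 1?ltnW //.
    by rewrite right_contraction_lt // mvnorm0 max_r.
  - rewrite ler0_norm ?subr_le0 ?lez_nat 1?ltnW // opprB.
    by rewrite left_contraction_lt // mvnorm0 max_l.
  - by rewrite /left_contraction /right_contraction subrr normr0 maxxx.
have S : `|scalar_product A B| = mvnorm A * mvnorm B * cos (max_angle dot V W).
  rewrite cos_max_angle minr_pMr // -L -M.
  have [ltpq|ltqp|eqpq] := ltngtP p q.
  - rewrite (scalar_product_neq gA gB) ?ltn_eqF // normr0.
    by rewrite right_contraction_lt // mvnorm0 min_l.
  - rewrite (scalar_product_neq gA gB) ?gtn_eqF // normr0.
    by rewrite left_contraction_lt // mvnorm0 min_r.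
  - by rewrite -mvnorm_grade0 /left_contraction /right_contraction eqpq subrr minxx.
split=> //; split; first by rewrite cos_asym_angle.
split; first by rewrite cos_asym_angle.
split=> //; split; last by rewrite cos_asym_angle (mvnorm_wedge he hA hB).
by move=> /eqP p0 /eqP q0; rewrite /hestenes_product p0 q0.
Qed.
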